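(* Assume $W$ is finite. Then for each $x\in W$ there exists a unique element $P_x\in\mathcal{H}$ such that $\langle P_x, C_y\rangle=\delta_{x,y}$ for all $y\in W$.
   Context: Let $(W,S)$ be a Coxeter system with length function $\ell\colon W\to\mathbf{Z}_{\geq 0}$ and identity $e$. The Hecke algebra $\mathcal{H}$ is the free $\mathbf{Z}[v,v^{-1}]$-module $\bigoplus_{x\in W}\mathbf{Z}[v,v^{-1}]T_x$ with $\mathbf{Z}[v,v^{-1}]$-algebra structure given by $T_xT_y=T_{xy}$ if $\ell(xy)=\ell(x)+\ell(y)$, and $(T_s+1)(T_s-v^{-2})=0$ for all $s\in S$; the unit is $T_e=1$. Set $H_x=v^{\ell(x)}T_x$ for $x\in W$; each $H_x$ is invertible. Let $d\colon\mathcal{H}\to\mathcal{H}$, $H\mapsto\overline{H}$, be the ring involution with $d(v)=v^{-1}$ and $d(H_x)=H_{x^{-1}}^{-1}$. An element $C\in\mathcal{H}$ is self-dual if $\overline{C}=C$. For each $x\in W$, $C_x$ denotes the Kazhdan-Lusztig basis element: the unique self-dual element of $\mathcal{H}$ such that $C_x\in H_x+\sum_{y\in W}v\mathbf{Z}[v]H_y$. The form $\langle\cdot,\cdot\rangle\colon\mathcal{H}\otimes\mathcal{H}\to\mathbf{Z}[v,v^{-1}]$ is the symmetric $\mathbf{Z}[v,v^{-1}]$-bilinear form with $\langle H_x,H_y\rangle=\delta_{x,y}$ for $x,y\in W$. *)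

(* Defs.v *)
From HB Require Import structures.
From mathcomp Require Import all_boot all_order all_fingroup all_algebra.
From mathcomp Require Import sesquilinear.
From mathcomp Require Import boolp.

Set Implicit Arguments.
Unset Strict Implicit.
Unset Printing Implicit Defensive.

Import GroupScope GRing.Theory.
Local Open Scope ring_scope.

(* The ring Z[v, v^-1], as the subring of Z(v) of all fractions p / v^n. *)

Definition is_laurent : {pred {fraction {poly int}}} :=
  fun f => `[< exists (p : {poly int}) (n : nat), f = tofrac p / tofrac 'X ^+ n >].

Lemma tofracX_neq0 n : tofrac ('X : {poly int}) ^+ n != 0.
Proof. by rewrite expf_neq0 // tofrac_eq0 polyX_eq0. Qed.

Fact is_laurent_subring : subring_closed is_laurent.
Proof.
split.
- by apply/asboolP; exists 1, 0; rewrite rmorph1 expr0 divr1.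
- move=> _ _ /asboolP[p [m ->]] /asboolP[q [n ->]]; apply/asboolP.
  exists (p * 'X^n - q * 'X^m), (m + n)%N.
  rewrite rmorphB !rmorphM !rmorphXn exprD mulrBl.
  by rewrite -mulf_div divff ?tofracX_neq0 // mulr1
       [tofrac 'X ^+ m * _]mulrC -mulf_div divff ?tofracX_neq0 // mulr1.
- move=> _ _ /asboolP[p [m ->]] /asboolP[q [n ->]]; apply/asboolP.
  by exists (p * q), (m + n)%N; rewrite rmorphM exprD mulf_div.
Qed.

HB.instance Definition _ :=
  GRing.isSubringClosed.Build _ is_laurent is_laurent_subring.

Record laurent := Laurent {
  laurent_val :> {fraction {poly int}};
  _ : laurent_val \in is_laurent }.

HB.instance Definition _ := [isSub for laurent_val].
HB.instance Definition _ := [Choice of laurent by <:].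
HB.instance Definition _ := [SubChoice_isSubComNzRing of laurent by <:].

Definition laurent_unit : {pred laurent} :=
  fun a => (val a != 0) && ((val a)^-1 \in is_laurent).

Definition laurent_inv (a : laurent) : laurent := insubd a (val a)^-1.

Fact laurent_mulVr : {in laurent_unit, left_inverse 1 laurent_inv *%R}.
Proof.
move=> a /andP[a0 aL]; apply: val_inj.
by rewrite rmorphM rmorph1 /= val_insubd aL mulVf.
Qed.

Fact laurent_unitP (a b : laurent) : b * a = 1 -> laurent_unit a.
Proof.
move=> /(congr1 val); rewrite rmorphM rmorph1 /= => ba1.
have a0 : val a != 0.
  by apply/negP => /eqP a0; move/eqP: ba1; rewrite a0 mulr0 eq_sym oner_eq0.
apply/andP; split=> //.
by rewrite (_ : (val a)^-1 = val b) ?(valP b) // -[RHS](mulfK a0) ba1 mul1r.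
Qed.

Fact laurent_inv_out : {in [predC laurent_unit], laurent_inv =1 id}.
Proof.
move=> a aN; apply: val_inj; rewrite /laurent_inv val_insubd.
case: ifP => // aL; case: (eqVneq (val a) 0) => [->|a0]; first exact: invr0.
by case/negP: aN; apply/andP.
Qed.

HB.instance Definition _ := GRing.ComNzRing_hasMulInverse.Build laurent
  laurent_mulVr laurent_unitP laurent_inv_out.
HB.instance Definition _ :=
  [SubComUnitRing_isSubIntegralDomain of laurent by <:].

Fact laurentX_subproof : tofrac 'X \in is_laurent.
Proof. by apply/asboolP; exists 'X, 0; rewrite expr0 divr1. Qed.

Definition v : laurent := Laurent laurentX_subproof.

Lemma v_unit : v \is a GRing.unit.
Proof.
apply/andP; split; first by have := tofracX_neq0 1; rewrite expr1.
by apply/asboolP; exists 1, 1%N; rewrite rmorph1 expr1 mul1r.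
Qed.

Definition in_vZv (a : laurent) : Prop :=
  exists p : {poly int}, a = v * (map_poly intr p).[v].

(* (W, S) is a Coxeter system: S consists of elements of order 2, generates W,
   and W is presented by S subject to the relations (s t)^m(s,t) = 1, where
   m(s,t) is the order of s t (always finite here).  The presentation is
   expressed by its universal property among all groups. *)
Definition coxeter_system (W : finGroupType) (S : {set W}) : Prop :=
  [/\ forall s, s \in S -> #[s] = 2%N,
      <<S>> = [set: W]
    & forall (G : groupType) (f : W -> G),
        (forall s t, s \in S -> t \in S -> ((f s * f t) ^+ #[s * t] = 1)%g) ->
        exists phi : {multiplicative W -> G}, {in S, phi =1 f}].

Section Hecke.

Variables (W : finGroupType) (S : {set W}).

Definition is_word_length (x : W) (n : nat) : bool :=
  [exists c : {ffun 'I_n -> W},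
     [forall i, c i \in S] && (x == \prod_i c i)%g].

Fact word_length_ex (x : W) :
  exists n, (x \in <<S>>) ==> is_word_length x n.
Proof.
case: (boolP (x \in <<S>>)) => [/gen_prodgP[n [c cS ->]]|_]; last by exists 0.
exists n; apply/existsP; exists (finfun c); apply/andP; split.
  by apply/forallP => i; rewrite ffunE.
by apply/eqP; apply: eq_bigr => i _; rewrite ffunE.
Qed.

(* Minimal number of factors in an expression of x as a product of elements
   of S; junk value 0 outside <<S>>. *)
Definition length (x : W) : nat := ex_minn (word_length_ex x).

Variables (A : algType laurent) (T : W -> A).

Definition hecke_algebra : Prop :=
  [/\ forall h : A, exists! c : {ffun W -> laurent}, h = \sum_x c x *: T x,
      forall x y, length (x * y)%g = (length x + length y)%N ->
        T x * T y = T (x * y)%g,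
      forall s, s \in S -> (T s + 1) * (T s - (v ^- 2)%:A) = 0
    & T 1%g = 1].

Definition Hbasis (x : W) : A := v ^+ length x *: T x.

(* d (H_x) = H_{x^-1}^-1 is stated as a two-sided inverse, since A carries no
   inversion operation. *)
Definition hecke_involution (d : {rmorphism A -> A}) : Prop :=
  [/\ involutive d,
      d v%:A = (v^-1)%:A
    & forall x, d (Hbasis x) * Hbasis x^-1%g = 1 /\
                Hbasis x^-1%g * d (Hbasis x) = 1].

Definition self_dual (d : A -> A) (h : A) : Prop := d h = h.

Definition kazhdan_lusztig (d : A -> A) (x : W) (h : A) : Prop :=
  self_dual d h /\
  exists2 c : W -> laurent, forall y, in_vZv (c y)
    & h = Hbasis x + \sum_y c y *: Hbasis y.

Definition hecke_form (form : {biscalar A}) : Prop :=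
  (forall a b, form a b = form b a) /\
  (forall x y, form (Hbasis x) (Hbasis y) = (x == y)%:R).

End Hecke.

(* Main.v *)
Require Import Defs.
From HB Require Import structures.
From mathcomp Require Import all_boot all_order all_fingroup all_algebra.
From mathcomp Require Import sesquilinear zify.

Set Implicit Arguments.
Unset Strict Implicit.
Unset Printing Implicit Defensive.

Import GRing.Theory.
Local Open Scope ring_scope.

(** With respect to the length function the matrix that expresses the C_y in
    the basis (H_x) is unitriangular: C_y is H_y plus a combination of H_x with
    x strictly shorter than y.  A unitriangular matrix is invertible over any
    ring, so the C_y have a unique dual basis for the form that makes (H_x)
    orthonormal; [dual_basis] builds it by descending induction on the length.

    The definition of C_y as a self-dual element does not mention triangularity:
    a priori C_y is H_y plus c_x H_x summed over all x, with c_x in vZ[v].  The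
    bound on the support is forced by self-duality.  The involution d is itself
    unitriangular, d(H_x) being H_x plus shorter terms ([d_Hbasis_coef]), which
    follows by induction on the length of x from d(H_s) = H_s - (v^-1 - v) and
    the multiplication rule for H_s H_z.  Hence, if x is at least as
    long as y and c_w = 0 for all w longer than x, then comparing the
    coefficients of H_x in C_y = d(C_y) gives that c_x is equal to its conjugate
    under v -> v^-1.  But vZ[v] and v^-1 Z[v^-1] meet only in 0
    ([vZv_bar_fixed]), so c_x = 0 ([kazhdan_lusztig_coef]).

    Coefficients in the basis (H_x) are read off throughout as values
    form h (H_x).  The multiplication rule for H_s needs that l(s z) and l(z)
    differ, a fact about Coxeter groups that comes from the sign character
    ([length_mul_neq]). *)

(** * Dual bases of unitriangular families *)

(** A height function suffices in place of a total order on the indices.  The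
    dual element at x is H x minus the multiples of the higher dual elements
    that are needed to kill its pairings with the higher C y. *)
Lemma dual_basis (R : comNzRingType) (V : lmodType R) (I : finType)
    (ht : I -> nat) (form : {biscalar V}) (H C : I -> V) :
    (forall a b, form a b = form b a) ->
    (forall h, h = \sum_y form h (H y) *: H y) ->
    (forall x y, (ht y <= ht x)%N -> form (H x) (C y) = (x == y)%:R) ->
  forall x, exists! P : V, forall y, form P (C y) = (x == y)%:R.
Proof.
move=> form_sym H_span C_tri x.
(* By induction on the height, each H y lies in the span of the C z. *)
have C0 Q : (forall y, form Q (C y) = 0) -> Q = 0.
  move=> QC; suff QH y : form Q (H y) = 0.
    by rewrite (H_span Q) big1 // => y _; rewrite QH scale0r.
  have [n] := ubnP (ht y); elim: n y => // n IHn y /ltnSE le_y_n.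
  have /eqP := QC y; rewrite (H_span (C y)) linear_sumr (bigD1 y) //= big1.
    by rewrite addr0 linearZr_LR /= form_sym C_tri // eqxx mul1r => /eqP.
  move=> z z_y; rewrite linearZr_LR /=; have [le_yz|lt_zy] := leqP (ht y) (ht z).
    by rewrite form_sym C_tri // (negPf z_y) mul0r.
  by rewrite IHn ?mulr0 // (leq_trans lt_zy).
(* The induction descends along the height, starting from its maximum. *)
have ex_dual : exists P, forall y, form P (C y) = (x == y)%:R.
  have [n] := ubnP (\max_z ht z - ht x); elim: n x => // n IHn x /ltnSE le_x_n.
  have /fin_all_exists[P PC] y :
      exists P, (ht x < ht y)%N -> forall z, form P (C z) = (y == z)%:R.
    have [lt_xy|_] := ltnP (ht x) (ht y); last by exists 0.
    have [|P PC] := IHn y; last by exists P.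
    rewrite (leq_trans _ le_x_n) // ltn_sub2l //.
    by rewrite (leq_trans lt_xy) // leq_bigmax.
  exists (H x - \sum_(y | (ht x < ht y)%N) form (H x) (C y) *: P y) => z.
  rewrite linearBl linear_sumlz /=.
  rewrite (eq_bigr (fun y => form (H x) (C y) * (y == z)%:R)); last first.
    by move=> y lt_xy; rewrite linearZl_LR /= PC.
  have [lt_xz|le_zx] := ltnP (ht x) (ht z).
    rewrite (bigD1 z) //= eqxx mulr1 big1 => [|y /andP[_ /negPf->]]; last first.
      by rewrite mulr0.
    rewrite addr0 subrr; case: eqVneq => // x_z.
    by rewrite x_z ltnn in lt_xz.
  rewrite C_tri // big1 ?subr0 // => y lt_xy; case: eqVneq => [y_z|_].
    by rewrite y_z ltnNge le_zx in lt_xy.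
  by rewrite mulr0.
have [P PC] := ex_dual; exists P; split=> // Q QC.
apply/eqP; rewrite -subr_eq0; apply/eqP/C0 => y.
by rewrite linearBl /= PC QC subrr.
Qed.

(** * Laurent polynomials *)

(** In Z(v) the value of p at v is the fraction of p itself, and polynomials
    embed into their fractions. *)
Lemma horner_v_inj : injective (fun p : {poly int} => (map_poly intr p).[v]).
Proof.
pose iota : {rmorphism laurent -> {fraction {poly int}}} := (val : laurent -> _).
move=> p q /(congr1 iota).
have iotaE (r : {poly int}) : iota (map_poly intr r).[v] = tofrac r.
  rewrite -horner_map.
  rewrite -[in RHS](comp_polyXr r) /comp_poly.
  rewrite -[RHS]horner_map.
  rewrite -!map_poly_comp; congr (_.[_]); apply: eq_map_poly => a.
  rewrite [LHS](rmorph_int iota a); symmetry.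
  pose f : {rmorphism int -> {fraction {poly int}}} := @tofrac {poly int} \o polyC.
  by have := rmorph_int f a; rewrite intz.
by rewrite !iotaE => /eqP; rewrite tofrac_eq => /eqP.
Qed.

(** The exponents of v on the left are positive and those on the right
    negative.  Clearing denominators by v^(n+1), with n the size of p, turns the
    right-hand side into a polynomial q of degree at most n, the reversal of p,
    while the left-hand side becomes p * 'X^(n+2), of larger degree if p is
    nonzero. *)
Lemma vZv_bar_fixed (p : {poly int}) :
  v * (map_poly intr p).[v] = v^-1 * (map_poly intr p).[v^-1] -> p = 0.
Proof.
set n := size p => bar_fixed.
pose q := \poly_(i < n.+1) p`_(n - i).
have pq : p * 'X^(n + 2) = q.
  apply: horner_v_inj => /=.
  rewrite rmorphM /= map_polyXn hornerM hornerXn.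
  have -> : (map_poly intr q).[v] = v ^+ n * (map_poly intr p).[v^-1].
    have szq (r : {poly int}) :
        (size r <= n.+1)%N -> (size (map_poly intr r : {poly laurent}) <= n.+1)%N.
      by apply: leq_trans; rewrite size_poly.
    rewrite (horner_coef_wide _ (szq q (size_poly _ _))).
    rewrite (horner_coef_wide _ (szq p (leqnSn n))) big_distrr /=.
    rewrite (reindex_inj rev_ord_inj) /=; apply: eq_bigr => i _.
    have le_in : (i <= n)%N by rewrite -ltnS.
    rewrite !coef_map /= coef_poly subSS ltnS leq_subr subKn //.
    by rewrite mulrCA exprVn exprB ?v_unit.
  by rewrite mulrC addn2 !exprSr -!mulrA bar_fixed mulVKr ?v_unit.
apply/eqP/negPn/negP => p0.
have := size_poly n.+1 (fun i => p`_(n - i)).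
rewrite -/q -pq size_mulXn // -/n; lia.
Qed.

(** * The length function of a Coxeter group *)

Section Length.

Variables (W : finGroupType) (S : {set W}).
Hypothesis coxWS : coxeter_system S.

Local Notation len := (length S).

Lemma is_word_lengthP (x : W) n :
  reflect (exists w : seq W,
             [/\ size w = n, {subset w <= S} & x = (\prod_(s <- w) s)%g])
          (is_word_length S x n).
Proof.
apply: (iffP existsP) => [[c /andP[/forallP cS /eqP->]]|[w [<- wS ->]]].
  exists (codom c); split; first by rewrite size_codom card_ord.
    by move=> _ /codomP[i ->]; exact: cS.
  by rewrite big_map enumT.
exists [ffun i => nth 1%g w (val i)]; apply/andP; split.
  by apply/forallP => i; rewrite ffunE; apply/wS/mem_nth/ltn_ord.
by apply/eqP; rewrite (big_nth 1%g) big_mkord; apply: eq_bigr => i _; rewrite ffunE.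
Qed.

Lemma length_le x n : is_word_length S x n -> (len x <= n)%N.
Proof. by rewrite /length => xn; case: ex_minnP => m _; apply; rewrite xn implybT. Qed.

Lemma length_word x : is_word_length S x (len x).
Proof.
rewrite /length; case: ex_minnP => m /implyP + _; apply.
by case: coxWS => _ -> _; rewrite inE.
Qed.

Lemma mulss s : s \in S -> (s * s = 1)%g.
Proof. by case: coxWS => ord2 _ _ /ord2 s2; rewrite -[RHS](expg_order s) s2. Qed.

Lemma length1 : len 1%g = 0%N.
Proof.
apply/eqP; rewrite -leqn0; apply/length_le/is_word_lengthP.
by exists [::]; split=> //; rewrite big_nil.
Qed.

Lemma length_mul s y : s \in S -> (len (s * y)%g <= (len y).+1)%N.
Proof.
move=> sS; have /is_word_lengthP[w [szw wS yE]] := length_word y.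
apply/length_le/is_word_lengthP; exists (s :: w); split.
- by rewrite /= szw.
- by move=> t /[!inE] /predU1P[->|/wS].
- by rewrite big_cons yE.
Qed.

Lemma length_eq0 x : len x = 0%N -> x = 1%g.
Proof.
move=> x0; have /is_word_lengthP[w []] := length_word x.
by rewrite x0 => /size0nil -> _ ->; rewrite big_nil.
Qed.

Lemma length_gen s : s \in S -> len s = 1%N.
Proof.
move=> sS; have := length_mul 1%g sS; rewrite mulg1 length1.
case: (len s) (@length_eq0 s) => [s1 _|[]] //.
by case: coxWS => /(_ s sS) + _ _; rewrite s1 // order1.
Qed.

Lemma length_decomp x n : len x = n.+1 ->
  exists s x', [/\ s \in S, x = (s * x')%g & len x' = n].
Proof.
move=> xn; have /is_word_lengthP[w []] := length_word x.
rewrite xn; case: w => // s w [szw] wS; rewrite big_cons => xE.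
have sS : s \in S by rewrite wS ?mem_head.
exists s, (\prod_(t <- w) t)%g; split=> //; apply/eqP; rewrite eqn_leq.
rewrite length_le; last first.
  by apply/is_word_lengthP; exists w; split=> // t tw; rewrite wS // inE tw orbT.
by rewrite -ltnS -xn xE length_mul.
Qed.

(** Multiplication by a generator changes the parity of the length.  The
    universal property provides the sign character W -> {perm bool} that sends
    every generator to the transposition t; equal lengths of s * y and y would
    give t = 1. *)
Lemma length_mul_neq s y : s \in S -> len (s * y)%g != len y.
Proof.
move=> sS; pose t := tperm true false.
have t2 : (t * t = 1)%g := tperm2 _ _.
have [|phi phiS] := (let: And3 _ _ univ := coxWS in univ) {perm bool} (fun=> t).
  by move=> *; rewrite t2 expg1n.
have phi_word x n : is_word_length S x n -> phi x = (t ^+ n)%g.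
  move=> /is_word_lengthP[w [<- wS ->]]; elim: w wS => [|u w IHw] wS.
    by apply: (mulgI (phi 1%g)); rewrite big_nil expg0 -gmulfM !mulg1.
  rewrite big_cons gmulfM phiS ?wS ?mem_head // IHw ?expgS // => z zw.
  by rewrite wS // inE zw orbT.
apply/negP => /eqP sy; have := phi_word _ _ (length_word (s * y)%g).
rewrite gmulfM phiS // sy (phi_word y _ (length_word y)) -[RHS]mul1g.
move=> /mulIg /permP/(_ true); by rewrite perm1 tpermL.
Qed.

Lemma length_mul_case s y : s \in S ->
  len (s * y)%g = (len y).+1 \/ len y = (len (s * y)%g).+1.
Proof.
move=> sS; have := length_mul y sS; have := length_mul (s * y)%g sS.
rewrite mulgA mulss // mul1g; have := length_mul_neq y sS; lia.
Qed.

End Length.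

(** * The standard basis of the Hecke algebra *)

Section Hecke.

Variables (W : finGroupType) (S : {set W}).
Hypothesis coxWS : coxeter_system S.
Variables (A : algType laurent) (T : W -> A).
Hypothesis heckeA : hecke_algebra S T.

Local Notation len := (length S).
Local Notation H := (Hbasis S T).

Lemma Hbasis1 : H 1%g = 1.
Proof. by case: heckeA => _ _ _ T1; rewrite /Hbasis T1 length1 // scale1r. Qed.

Lemma Hbasis_mul x y : len (x * y)%g = (len x + len y)%N -> H x * H y = H (x * y)%g.
Proof.
case: heckeA => _ TM _ _ lxy; rewrite /Hbasis.
by rewrite -scalerAl -scalerAr scalerA TM // lxy exprD.
Qed.

(** The normalization H_s = v T_s turns the quadratic relation
    (T_s + 1)(T_s - v^-2) = 0 into this one. *)
Lemma Hbasis_quadratic s : s \in S -> H s * H s = 1 + (v^-1 - v) *: H s.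
Proof.
case: heckeA => _ _ quad _ sS; have := quad s sS.
rewrite /Hbasis length_gen // expr1 mulrDl mul1r mulrBr.
rewrite -scalerAr mulr1 addrA => /subr0_eq quad_s.
have {quad_s} TT : T s * T s = (v ^- 2)%:A - T s + v ^- 2 *: T s.
  by rewrite -quad_s addrK subrK.
have vV : v * v * v ^- 2 = 1 by rewrite -expr2 divrr // unitrX // v_unit.
rewrite -scalerAl -scalerAr scalerA TT scalerDr scalerBr !scalerA vV !scale1r.
by rewrite mulrBl mulVr ?v_unit // scalerBl scale1r addrAC addrA.
Qed.

Lemma Hbasis_span (form : {biscalar A}) : hecke_form S T form ->
  forall h, h = \sum_y form h (H y) *: H y.
Proof.
move=> [_ form_H] h; case: heckeA => /(_ h)[c [hE _]] _ _ _.
have {}hE : h = \sum_x (c x * v ^- len x) *: H x.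
  rewrite [LHS]hE; apply: eq_bigr => x _.
  by rewrite /Hbasis scalerA mulrVK // unitrX // v_unit.
rewrite {1}hE; apply: eq_bigr => y _; congr (_ *: _).
rewrite hE linear_sumlz (bigD1 y) //= big1 => [|x x_y]; last first.
  by rewrite linearZl_LR /= form_H (negPf x_y) mulr0.
by rewrite linearZl_LR /= form_H eqxx mulr1 addr0.
Qed.

Variable form : {biscalar A}.
Hypothesis form_std : hecke_form S T form.

Let form_H x y : form (H x) (H y) = (x == y)%:R.
Proof. by case: form_std. Qed.

(** Modulo terms no longer than z, left multiplication by H_s takes H_z to
    H_(s z): if s z is shorter than z, then H_s H_z = H_(s z) + (v^-1 - v) H_z. *)
Lemma Hbasis_gen_mul_coef s z y : s \in S -> (len z < len y)%N ->
  form (H s * H z) (H y) = (s * z == y)%g%:R.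
Proof.
move=> sS lt_zy; have length_s := length_gen coxWS sS.
have [up|down] := length_mul_case coxWS z sS.
  by rewrite Hbasis_mul ?form_H // length_s up.
have zE : z = (s * (s * z))%g by rewrite mulgA (mulss coxWS sS) mul1g.
have HsHz : H s * H (s * z)%g = H z by rewrite Hbasis_mul -?zE // length_s.
rewrite -HsHz mulrA Hbasis_quadratic // mulrDl mul1r -scalerAl HsHz.
rewrite linearDl /= form_H linearZl_LR /= form_H (_ : z == y = false) ?mulr0 ?addr0 //.
by apply: contraTF lt_zy => /eqP->; rewrite ltnn.
Qed.

(** * The involution and the Kazhdan-Lusztig basis *)

Variable d : {rmorphism A -> A}.
Hypothesis d_inv : hecke_involution S T d.

(** Both sides are inverse to H_s: the left one because s is an involution, the
    right one by the quadratic relation. *)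
Lemma d_gen s : s \in S -> d (H s) = H s - (v^-1 - v)%:A.
Proof.
move=> sS; case: d_inv => _ _ /(_ s)[dV _].
have sV : s^-1%g = s by apply/eqP; rewrite eq_invg_mul (mulss coxWS sS).
have HsV : H s * (H s - (v^-1 - v)%:A) = 1.
  by rewrite mulrBr Hbasis_quadratic // mulr_algr addrK.
by rewrite sV in dV; rewrite -[LHS]mulr1 -[X in _ * X = _]HsV mulrA dV mul1r.
Qed.

(** Unitriangularity of d: write x = s x' with x' shorter and expand
    d(H_x) = d(H_s) d(H_x') = (H_s - (v^-1 - v)) (H_x' + shorter terms); the
    only term that is not shorter than x is H_s H_x' = H_x. *)
Lemma d_Hbasis_coef x y : (len x <= len y)%N ->
  form (d (H x)) (H y) = (x == y)%:R.
Proof.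
elim: {x}(len x) {-2}x (erefl (len x)) y => [|n IHn] x lx y.
  by move=> _; rewrite (length_eq0 coxWS lx) Hbasis1 rmorph1 -Hbasis1 form_H.
have [s [x' [sS xE lx']]] := length_decomp coxWS lx.
rewrite {x}xE in lx *; rewrite lx => lt_ny.
have lx'y : (len x' < len y)%N by rewrite lx'.
rewrite -Hbasis_mul; last by rewrite lx lx' length_gen.
rewrite rmorphM /= d_gen // mulrBl linearBl /= mulr_algl linearZl_LR /=.
rewrite (IHn _ lx' y (ltnW lx'y)).
rewrite (_ : x' == y = false) ?mulr0 ?subr0; last first.
  by apply: contraTF lx'y => /eqP->; rewrite ltnn.
rewrite [d _](Hbasis_span form_std) mulr_sumr linear_sumlz (bigD1 x') //= big1.
  rewrite -scalerAr linearZl_LR /= (IHn _ lx' x') // eqxx mul1r addr0.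
  exact: Hbasis_gen_mul_coef.
move=> z z_x'; rewrite -scalerAr linearZl_LR /=.
have [le_nz|lt_zn] := leqP (len x') (len z).
  by rewrite (IHn _ lx' z) // eq_sym (negPf z_x') mul0r.
rewrite Hbasis_gen_mul_coef ?(ltn_trans lt_zn) //.
rewrite (_ : (s * z)%g == y = false) ?mulr0 //; apply/negP => /eqP szy.
by have := length_mul coxWS z sS; rewrite szy leqNgt (leq_trans _ lx'y).
Qed.

(** On coefficients from vZ[v], the involution d acts by v -> v^-1, because a
    ring morphism fixes the integers. *)
Lemma d_scale_vpoly (p : {poly int}) h :
  d ((v * (map_poly intr p).[v]) *: h) = (v^-1 * (map_poly intr p).[v^-1]) *: d h.
Proof.
have horner_alg (a : laurent) :
    ((map_poly intr p).[a])%:A = (map_poly intr p).[a%:A] :> A.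
  rewrite -[LHS](horner_map (in_alg A)) -map_poly_comp.
  by congr (_.[_]); apply: eq_map_poly => k; apply: (rmorph_int (in_alg A)).
case: d_inv => _ dv _.
rewrite -mulr_algl rmorphM -[RHS]mulr_algl; congr (_ * _).
rewrite -!scalerA -[v *: _]mulr_algl -[v^-1 *: _]mulr_algl rmorphM dv.
congr (_ * _); rewrite !horner_alg -dv -horner_map -map_poly_comp.
by congr (_.[_]); apply: eq_map_poly => k; apply: (rmorph_int d).
Qed.

(** Write h = H_x + sum_w c_w H_w with c_w in vZ[v]; the claim is that c_z = 0
    if z is not shorter than x, and longer z are treated first.  Once c_w = 0
    for all w longer than z, the involution leaves the contribution of H_x to
    the coefficient of H_z unchanged and replaces c_z by its conjugate, so
    self-duality makes c_z equal to its conjugate. *)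
Lemma kazhdan_lusztig_coef x h y : kazhdan_lusztig S T d x h ->
  (len x <= len y)%N -> form h (H y) = (x == y)%:R.
Proof.
move=> [d_h [c c_v hE]]; suff c0 z : (len x <= len z)%N -> c z = 0.
  move=> le_xy; rewrite hE linearDl /= form_H linear_sumlz (bigD1 y) //= big1.
    by rewrite c0 // scale0r linear0l !addr0.
  by move=> z z_y; rewrite linearZl_LR /= form_H (negPf z_y) mulr0.
have [n] := ubnP (\max_w len w - len z).
elim: n z {y} => // n IHn y /ltnSE le_y_n le_xy.
have sum_y (F : W -> A) : (forall z, z != y -> form (F z) (H y) = 0) ->
    form (\sum_z F z) (H y) = form (F y) (H y).
  by move=> F0; rewrite linear_sumlz (bigD1 y) //= big1 ?addr0.
have := congr1 (form^~ (H y)) d_h.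
rewrite hE rmorphD rmorph_sum /= !linearDl /= d_Hbasis_coef // form_H.
rewrite !sum_y => [/addrI|z z_y|z z_y]; last 2 first.
- by rewrite linearZl_LR /= form_H (negPf z_y) mulr0.
- have [p cz] := c_v z; have [le_zy|lt_yz] := leqP (len z) (len y).
    by rewrite cz d_scale_vpoly linearZl_LR /= d_Hbasis_coef // (negPf z_y) mulr0.
  rewrite IHn ?scale0r ?rmorph0 ?linear0l //; last first.
    by rewrite ltnW // (leq_ltn_trans le_xy).
  rewrite (leq_trans _ le_y_n) // ltn_sub2l //.
  by rewrite (leq_trans lt_yz) // leq_bigmax.
have [p cy] := c_v y.
rewrite linearZl_LR /= form_H eqxx mulr1 cy d_scale_vpoly linearZl_LR /=.
rewrite d_Hbasis_coef // eqxx mulr1.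
by move=> /esym/vZv_bar_fixed->; rewrite rmorph0 horner0 mulr0.
Qed.

End Hecke.

Theorem theorem3p7 (W : finGroupType) (S : {set W})
    (coxWS : coxeter_system S)
    (A : algType laurent) (T : W -> A) (heckeA : hecke_algebra S T)
    (d : {rmorphism A -> A}) (d_inv : hecke_involution S T d)
    (C : W -> A) (C_KL : forall x : W, kazhdan_lusztig S T d x (C x))
    (form : {biscalar A}) (form_std : hecke_form S T form) :
  forall x : W, exists! P : A, forall y : W, form P (C y) = (x == y)%:R.
Proof.
have [form_sym _] := form_std.
apply: (@dual_basis _ _ _ (length S) form (Hbasis S T)) => // [|x y le_yx].
  exact: Hbasis_span.
rewrite form_sym eq_sym.
exact: (kazhdan_lusztig_coef coxWS heckeA form_std d_inv (C_KL y)).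
Qed.
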